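(* Let $q$ be a prime power, let $\mathcal{A}\subseteq\mathbb{F}_q^{3\times4}$ be a set of $q^8$ matrices with $\operatorname{rank}(\mathbf{A}-\mathbf{B})\geq2$ for all distinct $\mathbf{A},\mathbf{B}\in\mathcal{A}$, and let $\mathcal{L}=\{\langle(\mathbf{I}_3|\mathbf{A})\rangle:\mathbf{A}\in\mathcal{A}\}$, where $\langle\mathbf{M}\rangle$ denotes the row space in $\mathbb{F}_q^7$. Then there is a set $\mathcal{E}$ of $q^4+q^3+2q^2+q+1$ further $3$-dimensional subspaces of $\mathbb{F}_q^7$ such that $\mathcal{C}=\mathcal{L}\cup\mathcal{E}$ is a plane subspace code of size $q^8+q^4+q^3+2q^2+q+1$.
   Context: A plane subspace code in $\mathbb{F}_q^7$ is a set of $3$-dimensional subspaces of $\mathbb{F}_q^7$ any two distinct members of which intersect in a subspace of dimension at most $1$. The set $\mathcal{L}$ is called a plane LMRD (lifted maximum rank distance) code. *)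

(* Defs.v *)
From mathcomp Require Import all_boot all_algebra.
From mathcomp Require Export finmap.
Set Implicit Arguments.
Unset Strict Implicit.
Unset Printing Implicit Defensive.
Import GRing.Theory.
Local Open Scope ring_scope.
Local Open Scope fset_scope.

Definition rowspace (F : finFieldType) (m n : nat) (M : 'M[F]_(m, n)) :
    {vspace 'rV[F]_n} :=
  <<[seq row i M | i : 'I_m]>>%VS.

Definition lifted (F : finFieldType) (A : 'M[F]_(3, 4)) : 'M[F]_(3, 7) :=
  row_mx 1%:M A.

Definition lifted_code (F : finFieldType) (A : {set 'M[F]_(3, 4)}) :
    {fset {vspace 'rV[F]_7}} :=
  [fset rowspace (lifted M) | M in A].

(* A plane is a plane of the projective space PG(6, q), so its \dim is 3. *)
Definition plane_subspace_code (F : finFieldType)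
    (C : {fset {vspace 'rV[F]_7}}) : Prop :=
  (forall U : {vspace 'rV[F]_7}, U \in C -> \dim U = 3%N) /\
  (forall U V : {vspace 'rV[F]_7}, U \in C -> V \in C -> U <> V ->
     (\dim (U :&: V) <= 1)%N).

(* Main.v *)
(* Let [S] be the subspace of vectors whose first three coordinates vanish.
   The planes of the lifted code meet [S] trivially, so any plane meeting [S] in
   a line (projectively) may be added to them.  Give every line [W] of
   [S = PG(3, q)] a point [c] of the quotient [PG(2, q)], and add the plane
   spanned by [W] and a lift of [c].  Two such planes meet in at most a point
   as soon as lines with the same [c] are disjoint: since there are
   [q ^ 2 + q + 1] points [c], this amounts to a parallelism (packing) of
   [PG(3, q)].

   For [q > 2], view [S] as [K ^ 2], where [K = F(w)] is the quadratic
   extension of [F].  With [B] generating another quadratic field inside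
   ['M_2(F)], the lines disjoint from the axis [0 x K] are the graphs of
   [x |-> x (a + B b)] with [a], [b] in [K].  The graphs with [b = 0] and the
   axis form a regular spread.  For [b != 0] the graph is coloured by the affine
   [F]-line [a + F b] of [K]: the difference of two distinct maps of the same
   colour is [(j + k B) b] with [j], [k] in [F], which is invertible because [B]
   has no eigenvalue in [F].  The class of [a + F b] is completed into a spread
   by the lines opposite to the regulus formed by the axis and the
   [{y = x m}] with [m] in [a + F b].  In ['M_2('F_2)] there is only one
   quadratic field, so [q = 2] is settled by an explicit table. *)
From HB Require Import structures.
Require Import Defs.
From mathcomp Require Import all_boot all_algebra ring.
Set Implicit Arguments.
Unset Strict Implicit.
Unset Printing Implicit Defensive.
Import GRing.Theory.
Local Open Scope ring_scope.

(** * Row spaces of matrices and their dimensions *)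

Section Rowspace.
Variable F : finFieldType.

Lemma mem_rowspaceP m n (M : 'M[F]_(m, n)) v :
  reflect (exists x : 'rV_m, v = x *m M) (v \in rowspace M).
Proof.
apply: (iffP idP) => [|[x ->]].
  pose X : m.-tuple 'rV[F]_n := [tuple row i M | i < m].
  have -> : rowspace M = <<X>>%VS by [].
  move=> /coord_span vE; exists (\row_i coord X i v).
  rewrite {1}vE mulmx_sum_row; apply: eq_bigr => i _.
  by rewrite mxE (nth_map i) ?size_enum_ord // nth_ord_enum.
rewrite mulmx_sum_row; apply: memv_suml => i _; apply/memvZ/memv_span.
by apply/mapP; exists i; rewrite ?mem_enum.
Qed.

Lemma dim_rowspace_le m n (M : 'M[F]_(m, n)) : (\dim (rowspace M) <= m)%N.
Proof. by apply: leq_trans (dim_span _) _; rewrite size_map size_enum_ord. Qed.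

Lemma dim_rowspace m n (M : 'M[F]_(m, n)) :
  (forall x : 'rV_m, x *m M = 0 -> x = 0) -> \dim (rowspace M) = m.
Proof.
move=> Minj; pose X : m.-tuple 'rV[F]_n := [tuple row i M | i < m].
have -> : rowspace M = <<X>>%VS by [].
suff /eqP -> : free X by rewrite size_tuple.
apply/freeP => k kX i; have /rowP/(_ i) : \row_i k i = 0.
  apply: Minj; rewrite mulmx_sum_row -[RHS]kX; apply: eq_bigr => j _.
  by rewrite mxE (nth_map i) ?size_enum_ord // nth_ord_enum.
by rewrite !mxE.
Qed.

(** [T] and [U :&: V] are subspaces of the three-dimensional [U] that meet trivially, so their
    dimensions add up to at most 3. Later [T] is the line in which an added plane meets [S]. *)
Lemma dim_capv_le1 (vT : vectType F) (U V T : {vspace vT}) :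
  \dim U = 3%N -> \dim T = 2%N -> (T <= U)%VS -> (T :&: V = 0)%VS ->
  (\dim (U :&: V) <= 1)%N.
Proof.
move=> dU dT sTU TV.
have := dimv_sum_cap T (U :&: V)%VS.
rewrite capvA (capv_idPl sTU) TV dimv0 dT addn0 => dE.
have : (\dim (T + U :&: V) <= 3)%N.
  by rewrite -dU dimvS // subv_add sTU capvSl.
by rewrite dE.
Qed.
End Rowspace.

(** * Intersections of lifted and added planes *)

Section Lifted.
Variable F : finFieldType.

Lemma mul_lifted m (X : 'M[F]_(m, 3)) (A : 'M[F]_(3, 4)) :
  X *m lifted A = row_mx X (X *m A).
Proof. by have := mul_mx_row X 1%:M A; rewrite mulmx1. Qed.

Lemma mem_liftedP (A : 'M[F]_(3, 4)) v :
  reflect (exists x : 'rV_3, v = row_mx x (x *m A)) (v \in rowspace (lifted A)).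
Proof.
by apply: (iffP (mem_rowspaceP _ _)) => -[x ->]; exists x; rewrite mul_lifted.
Qed.

Lemma dim_lifted (A : 'M[F]_(3, 4)) : \dim (rowspace (lifted A)) = 3%N.
Proof.
apply: dim_rowspace => x; rewrite mul_lifted => xA0.
by have /eq_row_mx[] : row_mx x (x *m A) = row_mx 0 0 by rewrite row_mx0.
Qed.

(** A common vector is [(x, x A) = (x, x B)], so [x] lies in the left kernel of [A - B], of
    dimension at most [3 - 2]. *)
Lemma dim_cap_lifted (A B : 'M[F]_(3, 4)) : (2 <= \rank (A - B)%R)%N ->
  (\dim (rowspace (lifted A) :&: rowspace (lifted B)) <= 1)%N.
Proof.
move=> rAB; pose Ker := row_base (kermx (A - B)%R).
apply: (@leq_trans (\rank (kermx (A - B)%R))); last first.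
  by rewrite mxrank_ker; case: (\rank _) rAB => [|[|[|]]].
apply: leq_trans _ (dim_rowspace_le (Ker *m lifted A)).
apply/dimvS/subvP => v; rewrite memv_cap => /andP[/mem_liftedP[x ->]].
case/mem_liftedP=> y /eq_row_mx[<- xAB].
have /submxP[z xE] : (x <= Ker)%MS.
  by rewrite eq_row_base; apply/sub_kermxP; rewrite mulmxBr xAB subrr.
by apply/mem_rowspaceP; exists z; rewrite mulmxA -xE mul_lifted.
Qed.

(** The point [c] is lifted with its last four coordinates zero. *)
Definition extension_mx (W : 'M[F]_(2, 4)) (c : 'rV[F]_3) : 'M[F]_(3, 7) :=
  block_mx 0 W c 0 : 'M[F]_(2 + 1, 3 + 4).

Definition extension_plane W c : {vspace 'rV[F]_7} :=
  rowspace (extension_mx W c).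

Lemma mul_extension_mx (y : 'rV[F]_3) W c :
  exists (x : 'rV_2) (k : F), y = row_mx x k%:M :> 'rV_(2 + 1) /\
    y *m extension_mx W c = row_mx (k *: c) (x *m W).
Proof.
have := mul_row_block (lsubmx (y : 'rV_(2 + 1))) (rsubmx (y : 'rV_(2 + 1))) 0 W c 0.
rewrite hsubmxK !mulmx0 add0r addr0 -/(extension_mx W c) => yW.
exists (lsubmx (y : 'rV_(2 + 1))), (rsubmx (y : 'rV_(2 + 1)) 0 0).
by rewrite -mul_scalar_mx -mx11_scalar hsubmxK.
Qed.

Lemma mem_extension_planeP W c v :
  reflect (exists (x : 'rV_2) (k : F), v = row_mx (k *: c) (x *m W))
    (v \in extension_plane W c).
Proof.
apply: (iffP (mem_rowspaceP _ _)) => [[y ->]|[x [k ->]]].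
  by have [x [k [_ ->]]] := mul_extension_mx y W c; exists x, k.
exists (row_mx x k%:M : 'rV_(2 + 1)).
have [x' [k' [/eq_row_mx[xx' kk'] ->]]] :=
  mul_extension_mx (row_mx x k%:M : 'rV_(2 + 1)) W c.
by rewrite xx' -!mul_scalar_mx kk'.
Qed.

Lemma dim_extension_plane W c : row_free W -> c != 0 ->
  \dim (extension_plane W c) = 3%N.
Proof.
move=> W_free c0; apply: dim_rowspace => y.
have [x [k [-> ->]]] := mul_extension_mx y W c => kx.
have [/eqP] : k *: c = 0 /\ x *m W = 0 by apply: eq_row_mx; rewrite row_mx0.
rewrite scaler_eq0 (negPf c0) orbF => /eqP ->; rewrite -(mul0mx _ W).
by move=> /(row_free_inj W_free) ->; rewrite raddf0 row_mx0.
Qed.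

Definition special_line (W : 'M[F]_(2, 4)) : {vspace 'rV[F]_7} :=
  rowspace (row_mx (0 : 'M_(2, 3)) W).

Lemma mul_special_line (x : 'rV[F]_2) (W : 'M[F]_(2, 4)) :
  x *m row_mx (0 : 'M_(2, 3)) W = row_mx 0 (x *m W).
Proof. by rewrite mul_mx_row mulmx0. Qed.

Lemma mem_special_lineP W (v : 'rV[F]_7) :
  reflect (exists x : 'rV_2, v = row_mx (0 : 'rV_3) (x *m W))
    (v \in special_line W).
Proof.
apply: (iffP (mem_rowspaceP _ _)) => -[x ->]; exists x;
  by rewrite -?mul_special_line //; apply: mul_special_line.
Qed.

Lemma dim_special_line W : row_free W -> \dim (special_line W) = 2%N.
Proof.
move=> W_free; apply: dim_rowspace => x; rewrite mul_special_line => xW.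
have [_] : (0 : 'rV[F]_3) = 0 /\ x *m W = 0 by apply: eq_row_mx; rewrite row_mx0.
by rewrite -(mul0mx _ W) => /(row_free_inj W_free).
Qed.

Lemma special_line_sub W c : (special_line W <= extension_plane W c)%VS.
Proof.
apply/subvP => v /mem_special_lineP[x ->]; apply/mem_extension_planeP.
by exists x, 0; rewrite scale0r.
Qed.

(** A lifted plane has no nonzero vector in [S], so it misses the special line of the added
    plane. *)
Lemma dim_cap_extension_lifted W c A : row_free W -> c != 0 ->
  (\dim (extension_plane W c :&: rowspace (lifted A)) <= 1)%N.
Proof.
move=> W_free c0; apply: (dim_capv_le1 (dim_extension_plane W_free c0)
  (dim_special_line W_free) (special_line_sub W c)).
apply/eqP; rewrite -subv0; apply/subvP => v; rewrite memv_cap memv0.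
case/andP=> /mem_special_lineP[x ->] /mem_liftedP[y /eq_row_mx[<- ->]].
by rewrite mul0mx row_mx0.
Qed.

(** If [c] and [c'] are proportional, the special line of the first plane misses the second plane.
    Otherwise a common vector has no component along [c], so the intersection lies in that of two
    different lines of [S]. *)
Lemma dim_cap_extension W W' c c' : row_free W -> row_free W' ->
    c != 0 -> c' != 0 -> ~~ (W <= W')%MS ->
    (forall k, c = k *: c' -> row_free (col_mx W W')) ->
  (\dim (extension_plane W c :&: extension_plane W' c') <= 1)%N.
Proof.
move=> W_free W'_free c0 c'0 WW' disj.
have [/sub_rVP[k /disj WW'_free]|ncc'] := boolP (c <= c')%MS.
  apply: (dim_capv_le1 (dim_extension_plane W_free c0)
    (dim_special_line W_free) (special_line_sub W c)).
  apply/eqP; rewrite -subv0; apply/subvP => v; rewrite memv_cap memv0.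
  case/andP=> /mem_special_lineP[x ->] /mem_extension_planeP[y [l]].
  case/eq_row_mx=> _ xy.
  have /(row_free_inj WW'_free) : row_mx x (- y) *m col_mx W W' = 0 *m col_mx W W'.
    by rewrite mul_row_col mul0mx mulNmx xy subrr.
  by rewrite -[0 in RHS]row_mx0 => /eq_row_mx[-> _]; rewrite mul0mx row_mx0.
have sub : (extension_plane W c :&: extension_plane W' c'
            <= special_line W :&: special_line W')%VS.
  apply/subvP => v; rewrite !memv_cap.
  case/andP=> /mem_extension_planeP[x [k ->]] /mem_extension_planeP[y [l]].
  case/eq_row_mx=> kl xy.
  suff k0 : k = 0.
    apply/andP; split; apply/mem_special_lineP.
      by exists x; rewrite k0 scale0r.
    by exists y; rewrite k0 scale0r xy.
  apply/eqP/negPn/negP => k0; case/negP: ncc'.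
  by apply/sub_rVP; exists (k^-1 * l); rewrite -scalerA -kl scalerA mulVf ?scale1r.
apply: leq_trans (dimvS sub) _.
suff : (\dim (special_line W :&: special_line W') < \dim (special_line W))%N.
  by rewrite dim_special_line.
rewrite ltn_neqAle dimvS ?capvSl // andbT.
apply: contra WW' => /eqP dE; apply/row_subP => i.
have : special_line W = (special_line W :&: special_line W')%VS.
  by apply/esym/eqP; rewrite eqEdim capvSl dE leqnn.
move=> WE; have : row_mx (0 : 'rV_3) (row i W) \in special_line W.
  by apply/mem_special_lineP; exists (delta_mx 0 i); rewrite -rowE.
rewrite WE memv_cap => /andP[_ /mem_special_lineP[x xE]].
have [_ ->] := @eq_row_mx _ _ 3 4 _ _ _ _ xE.
exact: submxMl.
Qed.
End Lifted.

(* The line with rows [W i] gets the point spanned by [c i] as its colour. *)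
Definition packing (F : finFieldType) (I : finType) (W : I -> 'M[F]_(2, 4))
    (c : I -> 'rV[F]_3) : Prop :=
  [/\ forall i, row_free (W i), forall i, c i != 0,
      forall i j, i != j -> ~~ (W i <= W j)%MS
    & forall i j k, i != j -> c i = k *: c j -> row_free (col_mx (W i) (W j))].

(** * The extended code obtained from a packing *)

Local Open Scope fset_scope.

Lemma packing_extension (F : finFieldType) (q : nat) (A : {set 'M[F]_(3, 4)})
    (I : finType) (W : I -> 'M[F]_(2, 4)) (c : I -> 'rV[F]_3) :
    #|A| = (q ^ 8)%N -> #|I| = (q ^ 4 + q ^ 3 + 2 * q ^ 2 + q + 1)%N ->
    (forall M N : 'M[F]_(3, 4),
       M \in A -> N \in A -> M <> N -> (2 <= \rank (M - N)%R)%N) ->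
    packing W c ->
  exists E : {fset {vspace 'rV[F]_7}},
    [/\ forall U : {vspace 'rV[F]_7}, U \in E -> \dim U = 3%N,
        #|` E| = (q ^ 4 + q ^ 3 + 2 * q ^ 2 + q + 1)%N,
        [disjoint lifted_code A & E]%fset,
        plane_subspace_code (lifted_code A `|` E)
      & #|` lifted_code A `|` E| =
          (q ^ 8 + q ^ 4 + q ^ 3 + 2 * q ^ 2 + q + 1)%N].
Proof.
move=> cardA cardI rankA [W_free c_neq0 W_neq disj].
pose E i := extension_plane (W i) (c i).
have E_cap i j : i != j -> (\dim (E i :&: E j) <= 1)%N.
  by move=> ij; apply: dim_cap_extension; auto => k; apply: disj.
have dimE i : \dim (E i) = 3%N by apply: dim_extension_plane.
(* Here and below, distinctness comes from dimensions: equal planes would meet in dimension 3 and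
   not in dimension at most 1. *)
have E_inj : injective E.
  move=> i j Eij; apply/eqP/negPn/negP => /E_cap.
  by rewrite Eij capvv dimE.
have L_inj : {in A &, injective (fun M => rowspace (lifted M))}.
  move=> M N MA NA LMN; apply/eqP/negPn/negP => /eqP /(rankA _ _ MA NA).
  by move/dim_cap_lifted; rewrite LMN capvv dim_lifted.
have memL U : reflect (exists2 M, M \in A & U = rowspace (lifted M))
    (U \in lifted_code A) by apply: imfsetP.
have memE U : reflect (exists i, U = E i) (U \in [fset E i | i : I]).
  by apply: (iffP (imfsetP _ _ _ _)) => [[i _ ->]|[i ->]]; exists i.
have card_E : #|` [fset E i | i : I]| = #|I|.
  by rewrite card_imfset //= cardE.
have cardL : #|` lifted_code A| = #|A|.
  by rewrite card_in_imfset //= cardE.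
have disjLE : [disjoint lifted_code A & [fset E i | i : I]]%fset.
  apply/fdisjointP => U /memL[M _ UM]; apply/negP => /memE[i UE].
  have := dim_cap_extension_lifted M (W_free i) (c_neq0 i).
  by rewrite -UM -[extension_plane _ _]UE capvv UM dim_lifted.
exists [fset E i | i : I]; split=> //.
- by move=> U /memE[i ->].
- by rewrite card_E cardI.
- split=> [U|U V]; rewrite in_fsetU.
    by case/orP=> [/memL[M _ ->]|/memE[i ->] //]; apply: dim_lifted.
  rewrite in_fsetU => /orP[/memL[M MA ->]|/memE[i ->]] /orP[/memL[N NA ->]|/memE[j ->]].
  + move=> MN; apply/dim_cap_lifted/rankA => // MN'.
    by case: MN; rewrite MN'.
  + by move=> _; rewrite capvC; apply: dim_cap_extension_lifted.
  + by move=> _; apply: dim_cap_extension_lifted.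
  + by move=> /eqP; rewrite (inj_eq E_inj); apply: E_cap.
- by rewrite cardfsU (eqP disjLE) cardfs0 subn0 card_E cardL cardA cardI !addnA.
Qed.

Local Close Scope fset_scope.

(** * A packing of [PG(3, 2)] *)

Section OrderTwo.
Local Open Scope nat_scope.

(* The pair [(a, b)] is the line through the points with binary digits [a] and
   [b]; each row is a spread. *)
Definition packing2 : seq (nat * nat) :=
  [:: (1, 2); (4, 8); (5, 10); (6, 11); (7, 9);
      (1, 4); (2, 8); (3, 13); (6, 9); (7, 11);
      (1, 6); (2, 9); (3, 12); (4, 10); (5, 8);
      (1, 8); (2, 12); (3, 5); (4, 11); (7, 10);
      (1, 10); (2, 13); (3, 4); (5, 9); (6, 8);
      (1, 12); (2, 4); (3, 9); (5, 11); (7, 8);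
      (1, 14); (2, 5); (3, 8); (4, 9); (6, 10)].

Definition bit (n j : nat) : bool := odd (n %/ 2 ^ j).

Definition gen2 (i r : nat) : nat :=
  let: (a, b) := nth (0, 0) packing2 i in if r is 0 then a else b.

(** Coordinate [j] of the combination of the two generators with coefficients [s] and [t] over
    [F_2]. It is kept in [bool] so that [vm_compute] can check the table; [mul_line2] carries the
    result over to [F]. *)
Definition pt2 (i : nat) (s t : bool) (j : nat) : bool :=
  (s && bit (gen2 i 0) j) (+) (t && bit (gen2 i 1) j).

Definition eq_bits (n : nat) (u v : nat -> bool) : bool :=
  all (fun j => u j == v j) (iota 0 n).

Lemma eq_bitsP n (u v : nat -> bool) :
  reflect (forall j : 'I_n, u j = v j) (eq_bits n u v).
Proof.
apply: (iffP allP) => [uv j|uv j].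
  by apply/eqP/uv; rewrite mem_iota add0n ltn_ord.
by rewrite mem_iota add0n => /= jn; rewrite (uv (Ordinal jn)).
Qed.

Definition all_bool (p : pred bool) := p true && p false.

Lemma all_boolP (p : pred bool) : reflect (forall b, p b) (all_bool p).
Proof. by apply: (iffP andP) => [[pt pf] []|pb]. Qed.

Lemma packing2_spread (i j : nat) (s t s' t' : bool) : i < 35 -> j < 35 ->
  i != j -> i %/ 5 == j %/ 5 -> eq_bits 4 (pt2 i s t) (pt2 j s' t') ->
  ~~ [|| s, t, s' | t'].
Proof.
have: all (fun i => all (fun j => (i != j) ==> (i %/ 5 == j %/ 5) ==>
  all_bool (fun s => all_bool (fun t => all_bool (fun s' => all_bool (fun t' =>
    eq_bits 4 (pt2 i s t) (pt2 j s' t') ==> ~~ [|| s, t, s' | t'])))))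
    (iota 0 35)) (iota 0 35) by vm_compute.
move=> /allP chk i35 j35; have {chk} := chk i; rewrite mem_iota i35 => /(_ isT).
move=> /allP/(_ j); rewrite mem_iota j35 => /(_ isT) /implyP chk /chk.
by move=> {chk} /implyP chk /chk /all_boolP/(_ s) /all_boolP/(_ t)
  /all_boolP/(_ s') /all_boolP/(_ t') /implyP.
Qed.

Lemma packing2_lines (i j : nat) (s t s' t' : bool) : i < 35 -> j < 35 ->
  i != j -> eq_bits 4 (pt2 i true false) (pt2 j s t) ->
  eq_bits 4 (pt2 i false true) (pt2 j s' t') -> false.
Proof.
have: all (fun i => all (fun j => (i != j) ==>
  all_bool (fun s => all_bool (fun t => all_bool (fun s' => all_bool (fun t' =>
    eq_bits 4 (pt2 i true false) (pt2 j s t) ==>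
    ~~ eq_bits 4 (pt2 i false true) (pt2 j s' t'))))))
    (iota 0 35)) (iota 0 35) by vm_compute.
move=> /allP chk i35 j35; have {chk} := chk i; rewrite mem_iota i35 => /(_ isT).
move=> /allP/(_ j); rewrite mem_iota j35 => /(_ isT) /implyP chk /chk.
by move=> {chk} /all_boolP/(_ s) /all_boolP/(_ t)
  /all_boolP/(_ s') /all_boolP/(_ t') /implyP chk /chk /negPf ->.
Qed.

Lemma packing2_free (i : nat) (s t : bool) : i < 35 ->
  eq_bits 4 (pt2 i s t) (fun=> false) -> ~~ (s || t).
Proof.
have: all (fun i => all_bool (fun s => all_bool (fun t =>
    eq_bits 4 (pt2 i s t) (fun=> false) ==> ~~ (s || t)))) (iota 0 35).
  by vm_compute.
move=> /allP chk i35; have {chk} := chk i; rewrite mem_iota i35 => /(_ isT).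
by move=> /all_boolP/(_ s) /all_boolP/(_ t) /implyP.
Qed.

Lemma eq_bits3_inj (m n : nat) : m < 8 -> n < 8 ->
  eq_bits 3 (bit m) (bit n) -> m = n.
Proof.
have: all (fun m => all (fun n => eq_bits 3 (bit m) (bit n) ==> (m == n))
    (iota 0 8)) (iota 0 8) by vm_compute.
move=> /allP chk m8 n8; have {chk} := chk m; rewrite mem_iota m8 => /(_ isT).
move=> /allP/(_ n); rewrite mem_iota n8 => /(_ isT) /implyP chk /chk.
by move=> /eqP.
Qed.
End OrderTwo.

(** * Transfer of the table to a field with two elements *)

Section FieldTwo.
Variable F : finFieldType.
Hypothesis F2 : #|F| = 2%N.

Lemma field2E (x : F) : x = (x != 0)%:R.
Proof.
case: eqP => [//|/eqP x0] /=; apply/eqP/negPn/negP => x1.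
have : uniq [:: 0; 1; x].
  by rewrite /= !inE !andbT negb_or eq_sym oner_neq0 eq_sym x0 eq_sym.
by move=> /card_uniqP s3; have := max_card (mem [:: 0; 1; x]); rewrite s3 F2.
Qed.

Lemma field2D (b c : bool) : b%:R + c%:R = (b (+) c)%:R :> F.
Proof.
case: b; case: c; rewrite /= ?addr0 ?add0r //.
apply/eqP/negPn/negP => /eqP two0; have := field2E (1 + 1).
case: eqP => // _ /= /eqP; rewrite -subr_eq0 addrK => /eqP.
by apply/eqP/oner_neq0.
Qed.

Lemma field2_inj (b c : bool) : b%:R = c%:R :> F -> b = c.
Proof. by case: b c => [] [] // /eqP; rewrite ?oner_eq0 // eq_sym oner_eq0. Qed.

Definition line2 (i : 'I_35) : 'M[F]_(2, 4) :=
  \matrix_(r, j) (bit (gen2 i r) j)%:R.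

(** Each row of the table has five lines. The successor of the row number runs from 1 to 7, hence
    over the nonzero vectors of [F_2 ^ 3]. *)
Definition color2 (i : 'I_35) : 'rV[F]_3 := \row_j (bit (i %/ 5).+1 j)%:R.

Lemma mul_line2 (x : 'rV_2) i j :
  (x *m line2 i) 0 j = (pt2 i (x 0 0 != 0) (x 0 1 != 0) j)%:R.
Proof.
rewrite mxE !big_ord_recl big_ord0 addr0 !mxE /pt2 -field2D -!mulnb !natrM.
rewrite -!field2E; congr (_ * _ + x 0 _ * _); exact: val_inj.
Qed.

Lemma packing_two : packing line2 color2.
Proof.
have span (i k : 'I_35) (x y : 'rV_2) : x *m line2 i = y *m line2 k ->
    eq_bits 4 (pt2 i (x 0 0 != 0) (x 0 1 != 0)) (pt2 k (y 0 0 != 0) (y 0 1 != 0)).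
  by move=> xy; apply/eq_bitsP => j; apply: field2_inj; rewrite -!mul_line2 xy.
have row0 (x : 'rV[F]_2) : ~~ ((x 0 0 != 0) || (x 0 1 != 0)) -> x = 0.
  rewrite negb_or !negbK => /andP[/eqP x0 /eqP x1]; apply/rowP => j.
  rewrite mxE; case: j => [[|[|//]]] j; [rewrite -x0|rewrite -x1];
  congr (x _ _); exact: val_inj.
have disj (i k : 'I_35) : i != k -> (i %/ 5 == k %/ 5)%N ->
    row_free (col_mx (line2 i) (line2 k)).
  move=> ik ik5; apply: inj_row_free => x; rewrite -[x](@hsubmxK _ 1 2 2).
  rewrite mul_row_col => /eqP; rewrite addr_eq0 -mulNmx => /eqP /span.
  move=> /(packing2_spread (ltn_ord i) (ltn_ord k) ik ik5).
  rewrite !negb_or => /and4P[x0 x1 y0 y1].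
  have -> : lsubmx (x : 'rV_(2 + 2)) = 0 by apply: row0; rewrite negb_or x0.
  have /eqP : - rsubmx (x : 'rV_(2 + 2)) = 0 by apply: row0; rewrite negb_or y0.
  by rewrite oppr_eq0 => /eqP ->; rewrite row_mx0.
have div7 (i : 'I_35) : ((i %/ 5).+1 < 8)%N by rewrite ltnS ltn_divLR.
have color_neq0 (i : 'I_35) : color2 i != 0.
  apply/eqP => /rowP ci.
  suff: (i %/ 5).+1 = 0%N by [].
  apply: eq_bits3_inj => //.
  by apply/eq_bitsP => j; apply: field2_inj; have := ci j; rewrite !mxE /bit div0n.
split=> [i|i|i k ik|i k a ik].
- apply: inj_row_free => x xi; apply: row0; apply: (packing2_free (ltn_ord i)).
  by apply/eq_bitsP => j; apply: field2_inj; rewrite -mul_line2 xi mxE.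
- exact: color_neq0.
- apply/negP => /submxP[y yE].
  have yiE (d : 'rV[F]_2) : d *m line2 i = (d *m y) *m line2 k.
    by rewrite -mulmxA -yE.
  move: (span _ _ _ _ (yiE (delta_mx 0 0))) (span _ _ _ _ (yiE (delta_mx 0 1))).
  rewrite !mxE !eqxx /= oner_neq0 => r0' r1'.
  by have := packing2_lines (ltn_ord i) (ltn_ord k) ik r0' r1'.
(* The factor [a] is nonzero, hence 1, so the colours are equal and both lines stand in the same row
   of the table. *)
- move=> cE; apply: disj => //; apply/eqP/succn_inj/eq_bits3_inj => //.
  apply/eq_bitsP => j; apply: field2_inj; have /rowP/(_ j) := cE.
  have a0 : a != 0.
    by apply/eqP => a0; have := color_neq0 i; rewrite cE a0 scale0r eqxx.
  by rewrite [a]field2E a0 scale1r !mxE.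
Qed.
End FieldTwo.

(** * A packing of [PG(3, q)] for [q > 2] *)

Lemma ord2P (P : 'I_2 -> Prop) : P 0 -> P 1 -> forall i, P i.
Proof.
move=> P0 P1 [[|[|//]] i2].
  by rewrite (_ : Ordinal _ = 0) //; apply: val_inj.
by rewrite (_ : Ordinal _ = 1) //; apply: val_inj.
Qed.

Lemma sum_ord2 (V : nmodType) (f : 'I_2 -> V) : \sum_i f i = f 0 + f 1.
Proof.
by rewrite !big_ord_recl big_ord0 addr0; congr (_ + f _); apply: val_inj.
Qed.

(** * The quadratic extension [K = F(w)] *)

Section QuadraticExtension.
Variables (F : fieldType) (n : F).
Hypothesis irr : forall x : F, x ^+ 2 - x + n != 0.

(* The row [(a, b)] stands for [a + b w] in [F(w)], where [w ^+ 2 = w - n];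
   multiplication by [v] is [u |-> u *m ext_mx v]. *)
Definition ext_mx (v : 'rV[F]_2) : 'M[F]_2 :=
  \matrix_(i, j) if i == 0 then v 0 j
                 else if j == 0 then - (n * v 0 1) else v 0 0 + v 0 1.

(** The element [w] has trace 1, norm [n] and conjugate [1 - w]; this gives the formula here and the
    one of [ext_conj]. *)
Definition ext_norm (v : 'rV[F]_2) : F :=
  v 0 0 ^+ 2 + v 0 0 * v 0 1 + n * v 0 1 ^+ 2.

Definition ext_conj (v : 'rV[F]_2) : 'rV[F]_2 :=
  \row_j if j == 0 then v 0 0 + v 0 1 else - v 0 1.

Definition row2 (a b : F) : 'rV[F]_2 := \row_j if j == 0 then a else b.

Lemma ext_mx_is_linear : linear ext_mx.
Proof.
move=> k u v; apply/matrixP; apply: ord2P; apply: ord2P;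
rewrite !mxE /=; ring.
Qed.

HB.instance Definition _ :=
  GRing.isLinear.Build F 'rV[F]_2 'M[F]_2 _ ext_mx ext_mx_is_linear.

Lemma mul_ext_mxC u v : u *m ext_mx v = v *m ext_mx u.
Proof. by apply/rowP; apply: ord2P; rewrite !mxE !sum_ord2 !mxE /=; ring. Qed.

Lemma ext_mxM u v : ext_mx u *m ext_mx v = ext_mx (u *m ext_mx v).
Proof.
by apply/matrixP; apply: ord2P; apply: ord2P;
  rewrite !mxE !sum_ord2 !mxE /= ?sum_ord2 ?mxE /=; ring.
Qed.

Lemma ext_mx_conj v : ext_mx v *m ext_mx (ext_conj v) = (ext_norm v)%:M.
Proof.
by apply/matrixP; apply: ord2P; apply: ord2P;
  rewrite !mxE !sum_ord2 !mxE /ext_norm /=; ring.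
Qed.

Lemma ext_norm_eq0 v : (ext_norm v == 0) = (v == 0).
Proof.
apply/eqP/eqP => [v0|->]; last by rewrite /ext_norm !mxE; ring.
have [b0|b0] := eqVneq (v 0 1) 0.
  apply/rowP; apply: ord2P; rewrite mxE //; apply/eqP.
  have : v 0 0 ^+ 2 == 0 by apply/eqP; rewrite -v0 /ext_norm b0; ring.
  by rewrite expf_eq0.
(* Divided by [b ^ 2], the norm of [a + b w] is the value of the irreducible polynomial at
   [- (a / b)]. *)
have /negP[] := irr (- (v 0 0 / v 0 1)); apply/eqP.
transitivity (ext_norm v / v 0 1 ^+ 2); last by rewrite v0 mul0r.
by rewrite /ext_norm; field.
Qed.

(** Multiplying by the conjugate turns [ext_mx v] into the nonzero scalar [ext_norm v]. *)
Lemma ext_mulIf m v (X Y : 'M_(m, 2)) :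
  v != 0 -> X *m ext_mx v = Y *m ext_mx v -> X = Y.
Proof.
rewrite -ext_norm_eq0 => v0 /(congr1 (fun Z => Z *m ext_mx (ext_conj v))).
by rewrite -!mulmxA ext_mx_conj !mul_mx_scalar => /(scalerI v0).
Qed.

Lemma ext_mx_eq0 v (x : 'rV_2) : x != 0 -> x *m ext_mx v = 0 -> v = 0.
Proof.
by move=> x0 xv; apply: (@ext_mulIf _ x) => //; rewrite mul_ext_mxC xv mul0mx.
Qed.

(** A determinant: for [u != 0] the kernel of [bracket u] is [F u], so its values tell the cosets of
    [F u] apart. *)
Definition bracket (u v : 'rV[F]_2) : F := u 0 0 * v 0 1 - u 0 1 * v 0 0.

Lemma bracket_eqP u v w : u != 0 -> bracket u v = bracket u w ->
  exists j, v - w = j *: u.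
Proof.
move=> u0 E.
have {}E : u 0 0 * (v - w) 0 1 = u 0 1 * (v - w) 0 0.
  by apply/eqP; rewrite -subr_eq0 !mxE; apply/eqP;
    transitivity (bracket u v - bracket u w); rewrite /bracket; [ring|];
    rewrite -/(bracket u v) -/(bracket u w) E subrr.
move: (v - w) E => {v w}v E; have [a0|a0] := eqVneq (u 0 0) 0; last first.
  exists (v 0 0 / u 0 0); apply/rowP; apply: ord2P; rewrite mxE ?divfK //.
  by apply: (mulfI a0); rewrite E; field.
have b0 : u 0 1 != 0.
  by apply: contra u0 => /eqP b0; apply/eqP/rowP; apply: ord2P; rewrite mxE.
exists (v 0 1 / u 0 1); apply/rowP; apply: ord2P; rewrite mxE ?divfK //.
by apply: (mulfI b0); rewrite -E a0; ring.
Qed.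

(** * A second quadratic field in ['M_2(F)] *)

Variable l : F.
Hypotheses (l0 : l != 0) (l1 : l != 1).

(* A conjugate of multiplication by [w], generating a field of matrices other
   than [F(w)]. *)
Definition twist : 'M[F]_2 :=
  diag_mx (row2 1 l^-1) *m ext_mx (row2 0 1) *m diag_mx (row2 1 l).

Lemma diag_row2K a b : a * b = 1 -> diag_mx (row2 1 a) *m diag_mx (row2 1 b) = 1%:M.
Proof.
move=> ab; apply/matrixP; apply: ord2P; apply: ord2P;
  rewrite mul_diag_mx !mxE /=; rewrite ?mulr1n ?mulr0n ?mulr0 ?mulr1 //.
Qed.

(** The matrix [j + k twist] is conjugate to multiplication by [j + k w], which is invertible unless
    [j = k = 0]. *)
Lemma twist_pencil (x : 'rV_2) j k : x != 0 ->
  j *: x + k *: (x *m twist) = 0 -> j = 0 /\ k = 0.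
Proof.
move=> x0; set D := diag_mx (row2 1 l^-1); set D' := diag_mx (row2 1 l).
have DD' : D *m D' = 1%:M by apply: diag_row2K; rewrite mulVf.
have D'D : D' *m D = 1%:M by apply: diag_row2K; rewrite mulfV.
have -> : j *: x + k *: (x *m twist) = x *m D *m ext_mx (row2 j k) *m D'.
  have -> : row2 j k = j *: row2 1 0 + k *: row2 0 1.
    by apply/rowP; apply: ord2P; rewrite !mxE /=; ring.
  have ext1 : ext_mx (row2 1 0) = 1%:M.
    by apply/matrixP; apply: ord2P; apply: ord2P; rewrite !mxE /=; ring.
  rewrite linearP linearZ /= ext1 mulmxDr mulmxDl -!scalemxAr -!scalemxAl.
  by rewrite mulmx1 -(mulmxA x) DD' mulmx1 /twist !mulmxA.
move=> /(congr1 (fun z => z *m D)); rewrite -mulmxA D'D mulmx1 mul0mx.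
move=> /ext_mx_eq0 jk; have xD0 : x *m D != 0.
  apply: contra x0 => /eqP xD0.
  by rewrite -[x]mulmx1 -DD' mulmxA xD0 mul0mx.
by have /rowP E := jk xD0; have := E 0; have := E 1; rewrite !mxE.
Qed.

(** In [ext_mx d] the lower right entry is the sum of the first row. In [twist] that row is [(0, l)]
    and that entry is 1, but [l != 1]. *)
Lemma twist_neq_ext d : twist <> ext_mx d.
Proof.
move=> /matrixP E; have := E 0 0; have := E 0 1; have := E 1 1.
rewrite /twist !mul_mx_diag !mul_diag_mx !mxE /=.
rewrite !mulr1 !mul1r add0r mulr1 mulVf // => E1 El E0; move: E1; rewrite -El -E0 add0r.
by move=> /esym/eqP; rewrite (negPf l1).
Qed.

(** If [b] and [b'] differed, dividing by [b - b'] would put [twist] into [K]. *)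
Lemma ext_twist_inj (a b a' b' : 'rV_2) :
  ext_mx a + twist *m ext_mx b = ext_mx a' + twist *m ext_mx b' ->
  a = a' /\ b = b'.
Proof.
move=> /eqP; rewrite -subr_eq0 opprD addrACA -mulmxBr -!linearB /= => /eqP.
have [/eqP|bb'] := eqVneq (b - b') 0.
  rewrite subr_eq0 => /eqP ->; rewrite subrr linear0 mulmx0 addr0 => aa'.
  split=> //; apply/eqP; rewrite -subr_eq0; apply/eqP.
  apply: (@ext_mx_eq0 _ (row2 1 0)); last by rewrite aa' mulmx0.
  by apply/eqP => /rowP/(_ 0)/eqP; rewrite !mxE oner_eq0.
move/eqP; rewrite addrC addr_eq0 => /eqP.
move=> /(congr1 (fun Z => Z *m ext_mx (ext_conj (b - b')))).
rewrite -mulmxA ext_mx_conj mul_mx_scalar mulNmx ext_mxM => tE.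
case: (@twist_neq_ext
  ((ext_norm (b - b'))^-1 *: - ((a - a') *m ext_mx (ext_conj (b - b'))))).
by rewrite linearZ linearN /= -tE scalerA mulVf ?scale1r // ext_norm_eq0.
Qed.

(** * Lines of [PG(3, q)] and their colours *)

Definition point (a : option F) : 'rV[F]_2 :=
  if a is Some t then row2 1 t else row2 0 1.

Lemma point_neq0 a : point a != 0.
Proof.
by apply/eqP; case: a => [t|] /rowP E; [have := E 0|have := E 1];
  rewrite !mxE => /eqP; rewrite oner_eq0.
Qed.

Lemma point_inj a b s t : s *: point a = t *: point b -> s != 0 -> a = b /\ s = t.
Proof.
move=> /rowP E s0; move: (E 0) (E 1) => {E}.
case: a b => [a|] [b|]; rewrite !mxE /= ?mulr0 ?mulr1.
- by move=> <- /(mulfI s0) ->.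
- by move=> s00; rewrite s00 eqxx in s0.
- by move=> <- s00; rewrite s00 mul0r eqxx in s0.
- by [].
Qed.

(** For fixed [d], these are representatives of the cosets of [F d] in [K]: multiples of a
    coordinate vector that is not proportional to [point d]. *)
Definition transversal (d : option F) (g : F) : 'rV[F]_2 :=
  if d is Some _ then row2 0 g else row2 g 0.

Lemma transversal_inj d g g' s :
  transversal d g - transversal d g' = s *: point d -> g = g'.
Proof.
move=> /rowP E; move: (E 0) (E 1) => {E}; case: d => [d|]; rewrite !mxE /=.
  rewrite subrr mulr1 => <-; rewrite mul0r => /eqP.
  by rewrite subr_eq0 => /eqP.
by rewrite mulr0 => /eqP; rewrite subr_eq0 => /eqP.
Qed.

(* The graphs, the axis [0 x K], and the lines spanned by [(u, u g)] and
   [(0, u d)], which meet the axis in a point; in the last case [g] only matters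
   modulo [F d]. *)
Definition line_index : Type :=
  ('rV[F]_2 * 'rV[F]_2) + (unit + option F * option F * F).

Definition line (i : line_index) : 'M[F]_(2, 4) :=
  match i with
  | inl (a, b) => row_mx 1%:M (ext_mx a + twist *m ext_mx b)
  | inr (inl _) => row_mx (0 : 'M_2) 1%:M
  | inr (inr (u, d, g)) =>
      col_mx (row_mx (point u) (point u *m ext_mx (transversal d g)))
             (row_mx (0 : 'rV_2) (point u *m ext_mx (point d)) : 'M_(1, 2 + 2))
  end.

(** For [v != 0] this stands for the affine line of all [z] with [bracket v z = s]. The remaining
    point, with [v = 0], is the line at infinity and goes to the regular spread. *)
Definition hue (v : 'rV[F]_2) (s : F) : 'rV[F]_3 := row_mx v s%:M.

(* The affine line [a + F b] is encoded by the linear form [bracket b] and its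
   value at [a], that is, by a point of the dual plane. *)
Definition color (i : line_index) : 'rV[F]_3 :=
  match i with
  | inl (a, b) => if b == 0 then hue 0 1 else hue b (bracket b a)
  | inr (inl _) => hue 0 1
  | inr (inr (_, d, g)) => hue (point d) (bracket (point d) (transversal d g))
  end.

Lemma mul_line_graph (x : 'rV_2) a b :
  x *m line (inl (a, b)) = row_mx x (x *m (ext_mx a + twist *m ext_mx b)).
Proof.
by have := mul_mx_row x 1%:M (ext_mx a + twist *m ext_mx b); rewrite mulmx1.
Qed.

Lemma mul_line_axis (x : 'rV_2) k :
  x *m line (inr (inl k)) = row_mx (0 : 'rV_2) x.
Proof.
by have := mul_mx_row x (0 : 'M[F]_2) 1%:M; rewrite mulmx1 mulmx0.
Qed.

Lemma mul_line_meet (x : 'rV_2) u d g :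
  x *m line (inr (inr (u, d, g))) =
  row_mx (x 0 0 *: point u)
    (point u *m ext_mx (x 0 0 *: transversal d g + x 0 1 *: point d)).
Proof.
have xE : x = row_mx (x 0 0)%:M (x 0 1)%:M :> 'rV_(1 + 1).
  apply/rowP; apply: ord2P; rewrite mxE; case: splitP => [[[|//] ?]|?] // _;
    by rewrite mxE ?ord1 eqxx mulr1n.
have := mul_row_col (x 0 0)%:M (x 0 1)%:M
  (row_mx (point u) (point u *m ext_mx (transversal d g)))
  (row_mx (0 : 'rV_2) (point u *m ext_mx (point d))).
rewrite -xE !mul_scalar_mx !scale_row_mx add_row_mx scaler0 addr0 => xW.
by rewrite linearD !linearZ mulmxDr /= -!scalemxAr.
Qed.

Lemma eq_row_mx4 (a b c d : 'rV[F]_2) :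
  row_mx a b = row_mx c d :> 'rV_4 -> a = c /\ b = d.
Proof. by move=> E; apply: (@eq_row_mx _ _ 2 2 _ _ _ _ E). Qed.

Lemma hue_inj k v s v' s' : hue v s = k *: hue v' s' -> v = k *: v' /\ s = k * s'.
Proof.
have -> : k *: hue v' s' = hue (k *: v') (k * s').
  by have := scale_row_mx k v' s'%:M; rewrite scale_scalar_mx.
move=> E; have [-> /rowP/(_ 0)] := @eq_row_mx _ _ 2 1 _ _ _ _ E.
by rewrite !mxE !mulr1n.
Qed.

Lemma color_neq0 i : color i != 0.
Proof.
have hue0 v s : hue v s = 0 -> v = 0 /\ s = 0.
  by rewrite -(scale0r (hue 0 0)) => /hue_inj; rewrite scale0r mul0r.
apply/eqP; case: i => [[a b]|[_|[[u d] g]]] /=; last 1 first.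
- by move=> /hue0[/eqP]; rewrite (negPf (point_neq0 d)).
- case: eqP => [_ /hue0[_ /eqP]|b0 /hue0[]//].
  by rewrite oner_eq0.
by move=> /hue0[_ /eqP]; rewrite oner_eq0.
Qed.

Lemma line_free i : row_free (line i).
Proof.
apply: inj_row_free => x; rewrite -[RHS](@row_mx0 _ 1 2 2).
case: i => [[a b]|[k|[[u d] g]]].
- by rewrite mul_line_graph => /eq_row_mx4[].
- by rewrite mul_line_axis => /eq_row_mx4[].
rewrite mul_line_meet => /eq_row_mx4[/eqP].
rewrite scaler_eq0 (negPf (point_neq0 u)) orbF => /eqP x0.
move=> /ext_mx_eq0 -/(_ (point_neq0 u)) /eqP.
rewrite x0 scale0r add0r scaler_eq0 (negPf (point_neq0 d)) orbF => /eqP x1.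
by apply/rowP; apply: ord2P; rewrite mxE.
Qed.

(** * Lines of the same colour are disjoint *)

Let skew i j := forall k (x y : 'rV_2), i <> j -> color i = k *: color j ->
  x *m line i = y *m line j -> x = 0.

(** Colours are nonzero, so [k] can be inverted; one vanishing coefficient vector forces the other
    to vanish because lines have rank 2. *)
Lemma skewC i j : skew i j -> skew j i.
Proof.
move=> ij k x y ji cE xy; have k0 : k != 0.
  by apply/eqP => k0; have := color_neq0 j; rewrite cE k0 scale0r eqxx.
have y0 : y = 0.
  by apply: (ij k^-1 y x); [move/esym|rewrite cE scalerA mulVf ?scale1r|].
by apply: (row_free_inj (line_free j)); rewrite xy y0 !mul0mx.
Qed.

Lemma hue_axis_point k v s : v != 0 -> hue 0 1 = k *: hue v s -> False.
Proof.
move=> v0 /hue_inj[/esym/eqP]; rewrite scaler_eq0 (negPf v0) orbF => /eqP ->.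
by rewrite mul0r => /eqP; rewrite oner_eq0.
Qed.

Lemma skew_graphs a b a' b' : skew (inl (a, b)) (inl (a', b')).
Proof.
move=> k x y ne /= cE; rewrite !mul_line_graph => /eq_row_mx4[<-].
case: (eqVneq b 0) cE => [b0|b0]; case: (eqVneq b' 0) => [b'0|b'0] cE.
- rewrite b0 b'0 linear0 mulmx0 !addr0 => xaa'; apply/eqP/negPn/negP => x0.
  case: ne; rewrite b0 b'0; congr (inl (_, _)); apply/eqP; rewrite -subr_eq0.
  by apply/eqP/(ext_mx_eq0 x0); rewrite linearB mulmxBr xaa' subrr.
- by case: (hue_axis_point b'0 cE).
- by case/hue_inj: cE => /eqP; rewrite scaler0 (negPf b0).
have [bE brE] := hue_inj cE.
have k0 : k != 0 by apply: contra b0 => /eqP k0; rewrite bE k0 scale0r.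
have brE' : bracket b a = bracket b a'.
  by rewrite brE bE /bracket !mxE; ring.
have [j aE] := bracket_eqP b0 brE'.
have b'E : b' = k^-1 *: b by rewrite bE scalerA mulVf ?scale1r.
move=> xE; apply/eqP/negPn/negP => x0; case: ne.
(* Equal colours give [a - a' = j b] and [b' = k^-1 b], so the two maps differ by
   [(j + (1 - k^-1) twist) b]. *)
have xE0 : (j *: x + (1 - k^-1) *: (x *m twist)) *m ext_mx b = 0 *m ext_mx b.
  have := subrr (x *m (ext_mx a + twist *m ext_mx b)); rewrite {2}xE.
  rewrite mul0mx => <-; rewrite b'E !mulmxDr opprD addrACA -mulmxBr -linearB aE.
  rewrite !linearZ /= mulmxDl -!scalemxAl scalerBl scale1r scalerN.
  by rewrite mulmxA.
have [j0 k1] := twist_pencil x0 (ext_mulIf b0 xE0).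
move: aE; rewrite j0 scale0r => /eqP; rewrite subr_eq0 => /eqP ->.
move/eqP: k1; rewrite subr_eq0 => /eqP k1.
by rewrite b'E -k1 scale1r.
Qed.

Lemma skew_graph_axis a b k : skew (inl (a, b)) (inr (inl k)).
Proof.
by move=> ? x y _ _; rewrite mul_line_graph mul_line_axis => /eq_row_mx4[].
Qed.

(** Let [(s u, u (s g + t d))] be a common vector. Equal colours give [a = g + j b] and
    [d = k^-1 b], so [u ((s j - t k^-1) + s twist) b = 0]. By [twist_pencil], [s = 0]. *)
Lemma skew_graph_meet a b u d g : skew (inl (a, b)) (inr (inr (u, d, g))).
Proof.
move=> k x y _ /= cE; case: (eqVneq b 0) cE => [_|b0] cE.
  by case: (hue_axis_point (point_neq0 d) cE).
have [bE brE] := hue_inj cE.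
have k0 : k != 0 by apply: contra b0 => /eqP k0; rewrite bE k0 scale0r.
have brE' : bracket b a = bracket b (transversal d g).
  by rewrite brE bE /bracket !mxE; ring.
have [j aE] := bracket_eqP b0 brE'.
rewrite mul_line_graph mul_line_meet => /eq_row_mx4[xE].
move: (y 0 0) (y 0 1) xE => s t -> E; have u0 := point_neq0 u.
suff [_ ->] : s * j - t * k^-1 = 0 /\ s = 0 by rewrite scale0r.
apply: (twist_pencil u0); apply: (ext_mulIf b0); rewrite mul0mx.
move: E; have -> : point d = k^-1 *: b by rewrite bE scalerA mulVf ?scale1r.
rewrite (_ : a = transversal d g + j *: b); last by rewrite -aE addrC subrK.
move=> /eqP; rewrite -subr_eq0 => /eqP <-.
rewrite !linearD !linearZ /= !mulmxDl -?scalemxAl.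
rewrite (mulmxA _ twist); move: (_ *m ext_mx b) (_ *m ext_mx b)
  (_ *m ext_mx (transversal d g)) => p q r.
by apply/rowP => i; rewrite !mxE; ring.
Qed.

Lemma skew_axis_meet k u d g : skew (inr (inl k)) (inr (inr (u, d, g))).
Proof. by move=> ? x y _ /hue_axis_point -/(_ (point_neq0 d)). Qed.

(** As [point] and [transversal] are normalised, equal colours force [d = d'] and [g = g'], so [u]
    and [u'] differ. The first halves of a common vector then vanish, and after division by [d] so
    do the second halves. *)
Lemma skew_meets u d g u' d' g' :
  skew (inr (inr (u, d, g))) (inr (inr (u', d', g'))).
Proof.
move=> k x y ne /hue_inj[]; rewrite -[LHS](scale1r (point d)).
move=> /point_inj -/(_ (oner_neq0 _))[dE kE]; subst d' k; rewrite mul1r.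
move=> /(bracket_eqP (point_neq0 d))[s /transversal_inj gg'].
rewrite !mul_line_meet => /eq_row_mx4[uu' xy].
have u_neq : u <> u' by move=> uu; apply: ne; rewrite uu gg'.
have x0 : x 0 0 = 0.
  by apply/eqP/negPn/negP => /(point_inj uu')[].
have y0 : y 0 0 = 0.
  by apply/eqP/negPn/negP => y0; case: (point_inj (esym uu') y0) => /esym.
move: xy; rewrite x0 y0 !scale0r !add0r !linearZ /= !scalemxAl.
move=> /(ext_mulIf (point_neq0 d)) x1y1.
have x1 : x 0 1 = 0.
  by apply/eqP/negPn/negP => /(point_inj x1y1)[].
by apply/rowP; apply: ord2P; rewrite mxE.
Qed.

Lemma skew_lines i j : skew i j.
Proof.
case: i j => [[a b]|[k|[[u d] g]]] [[a' b']|[k'|[[u' d'] g']]].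
- exact: skew_graphs.
- exact: skew_graph_axis.
- exact: skew_graph_meet.
- exact/skewC/skew_graph_axis.
- by case: k k' => [] [] ? x y.
- exact: skew_axis_meet.
- exact/skewC/skew_graph_meet.
- exact/skewC/skew_axis_meet.
- exact: skew_meets.
Qed.

(** * Different indices give different lines *)

Lemma point_pair_neq a : exists b, forall s t, s *: point a = t *: point b -> t = 0.
Proof.
exists (if a is Some _ then None else Some 0) => s t /esym E.
by apply/eqP/negPn/negP => /(point_inj E); case: a {E} => [?|] [].
Qed.

(** Vectors of the first line are tested against the second, for each pair of kinds. A graph or the
    axis leaves a line through the point [u' d'] of the axis at a vector built from a [point] not
    proportional to [point u']. *)
Lemma line_inj i j : i <> j -> ~~ (line i <= line j)%MS.
Proof.
move=> ij; apply/negP => /submxP[Y YE].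
have {Y YE} sub (x : 'rV_2) : exists y : 'rV_2, x *m line i = y *m line j.
  by exists (x *m Y); rewrite -mulmxA -YE.
have e0 : row2 1 0 != 0 by apply/eqP => /rowP/(_ 0)/eqP; rewrite !mxE oner_eq0.
case: i j ij sub => [[a b]|[k|[[u d] g]]] [[a' b']|[k'|[[u' d'] g']]] ij sub.
- case: ij; suff [-> ->] : a = a' /\ b = b' by [].
  apply: ext_twist_inj; apply/row_matrixP => i; rewrite !rowE.
  by have [y] := sub (delta_mx 0 i); rewrite !mul_line_graph => /eq_row_mx4[<-].
- have [y] := sub (row2 1 0); rewrite mul_line_graph mul_line_axis.
  by move=> /eq_row_mx4[/eqP]; rewrite (negPf e0).
- have [v vP] := point_pair_neq u'; have [y] := sub (point v).
  rewrite mul_line_graph mul_line_meet => /eq_row_mx4[/esym]; rewrite -[point v]scale1r.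
  by move=> /vP/eqP; rewrite oner_eq0.
- have [y] := sub (row2 1 0); rewrite mul_line_graph mul_line_axis.
  move=> /eq_row_mx4[<-]; rewrite mul0mx => /eqP; by rewrite (negPf e0).
- by case: ij; congr (inr (inl _)); case: (k); case: (k').
- have [v vP] := point_pair_neq u'.
  have [y] := sub (point v *m ext_mx (point d')).
  rewrite mul_line_axis mul_line_meet => /eq_row_mx4[/esym/eqP].
  rewrite scaler_eq0 (negPf (point_neq0 u')) orbF => /eqP ->.
  rewrite scale0r add0r !linearZ /= scalemxAl => /(ext_mulIf (point_neq0 d')).
  by move/esym; rewrite -[point v]scale1r => /vP/eqP; rewrite oner_eq0.
- have [y] := sub (row2 0 1); rewrite mul_line_graph mul_line_meet !mxE /=.
  rewrite !scale0r add0r scale1r => /eq_row_mx4[<-]; rewrite mul0mx.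
  move=> /(ext_mx_eq0 (point_neq0 u))/eqP.
  by rewrite (negPf (point_neq0 d)).
- have [y] := sub (row2 1 0); rewrite mul_line_axis mul_line_meet !mxE /=.
  by rewrite scale1r => /eq_row_mx4[/eqP]; rewrite (negPf (point_neq0 u)).
(* The first generator gives [u = u'] and [g = g'] modulo [F d']; the second gives [d = d'], whence
   [g = g']. *)
have [y] := sub (row2 1 0); rewrite !mul_line_meet !mxE /= scale0r addr0.
rewrite scale1r => /eq_row_mx4[]; rewrite -[LHS]scale1r.
case/point_inj => [|uE yE]; first exact: oner_neq0.
subst u'; rewrite -yE !scale1r => /eqP; rewrite -subr_eq0 -mulmxBr -linearB.
move=> /eqP/(ext_mx_eq0 (point_neq0 u))/eqP.
rewrite opprD addrA subr_eq0 => /eqP gE.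
have [z] := sub (row2 0 1); rewrite !mul_line_meet !mxE /= !scale0r add0r.
move=> /eq_row_mx4[/esym/eqP]; rewrite scaler_eq0 (negPf (point_neq0 u)) orbF.
move=> /eqP ->; rewrite scale0r add0r => /eqP; rewrite -subr_eq0 -mulmxBr -linearB.
move=> /eqP/(ext_mx_eq0 (point_neq0 u))/eqP; rewrite subr_eq0 => /eqP.
case/point_inj=> [|dE _]; first exact: oner_neq0.
by subst d'; case: ij; rewrite (transversal_inj gE).
Qed.

End QuadraticExtension.

(** The map [x |-> - (x ^ 2 - x)] takes the same value at 0 and 1. On a finite field it is therefore
    not onto, and any missed value serves as [n], in every characteristic. *)
Lemma exists_irreducible_quadratic (F : finFieldType) :
  exists n : F, forall x : F, x ^+ 2 - x + n != 0.
Proof.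
pose f (x : F) := - (x ^+ 2 - x).
pose avoided n := [forall x, f x != n].
have [/existsP[n /forallP nP]|] := boolP [exists n, avoided n].
  by exists n => x; apply: contra (nP x); rewrite addr_eq0 /f => /eqP ->; rewrite opprK.
rewrite negb_exists => /forallP f_onto.
have /fin_all_exists[g fg] : forall n, exists x, f x = n.
  move=> n; have := f_onto n; rewrite /avoided negb_forall => /existsP[x].
  by rewrite negbK => /eqP; exists x.
have g_inj : injective g := can_inj fg.
have f_inj : injective f := can_inj (canF_sym fg).
have /f_inj/eqP : f 0 = f 1 by rewrite /f; ring.
by rewrite eq_sym oner_eq0.
Qed.

Lemma packing_gt2 (F : finFieldType) : (2 < #|F|)%N ->
  exists (W : ('rV[F]_2 * 'rV[F]_2) + (unit + option F * option F * F) ->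
              'M[F]_(2, 4)) c, packing W c.
Proof.
move=> F_gt2; have [n irr] := exists_irreducible_quadratic F.
(* This is where [q > 2] enters. *)
have [l /andP[l0 l1]] : exists l : F, (l != 0) && (l != 1).
  apply/existsP; apply: contraLR F_gt2; rewrite negb_exists -leqNgt => /forallP l01.
  apply: leq_trans (card_size [:: 0; 1]); apply/subset_leq_card/subsetP => x _.
  by have := l01 x; rewrite negb_and !negbK !inE.
exists (line n l), (@color F).
split=> [i|i|i j /eqP|i j k /eqP ij cE].
- exact: line_free.
- exact: color_neq0.
- exact: line_inj.
apply: inj_row_free => z; rewrite -[z](@hsubmxK _ 1 2 2) mul_row_col.
move: (lsubmx _) (rsubmx _) => x y /eqP; rewrite addr_eq0 -mulNmx => /eqP xy.
have x0 : x = 0 := skew_lines irr l0 ij cE xy.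
have /eqP : - y = 0.
  by apply: (row_free_inj (line_free irr l j)); rewrite -xy x0 !mul0mx.
by rewrite oppr_eq0 => /eqP ->; rewrite x0 row_mx0.
Qed.

Local Open Scope fset_scope.

Theorem theorem3p2 (F : finFieldType) (q : nat) (hq : #|F| = q)
    (A : {set 'M[F]_(3, 4)}) (hA : #|A| = (q ^ 8)%N)
    (hrk : forall M N : 'M[F]_(3, 4),
       M \in A -> N \in A -> M <> N -> (2 <= \rank (M - N)%R)%N) :
  exists E : {fset {vspace 'rV[F]_7}},
    [/\ forall U : {vspace 'rV[F]_7}, U \in E -> \dim U = 3%N,
        #|` E| = (q ^ 4 + q ^ 3 + 2 * q ^ 2 + q + 1)%N,
        [disjoint lifted_code A & E]%fset,
        plane_subspace_code (lifted_code A `|` E)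
      & #|` lifted_code A `|` E| =
          (q ^ 8 + q ^ 4 + q ^ 3 + 2 * q ^ 2 + q + 1)%N].
Proof.
have: (1 < #|F|)%N := card_finNzRing_gt1 F.
rewrite leq_eqVlt => /orP[/eqP F2|/packing_gt2[W [c Wc]]].
  apply: (packing_extension hA _ hrk (packing_two (esym F2))).
  (* The 35 lines of the table are the required number at [q = 2]. *)
  by rewrite card_ord -hq -F2.
apply: (packing_extension hA _ hrk Wc).
(* There are [q ^ 4] graphs, one axis and [(q + 1) ^ 2 * q] lines meeting the axis in a point. *)
rewrite !card_sum !card_prod !card_option card_unit !card_mx hq.
ring.
Qed.
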